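(* Consider a sequence, indexed by $N\to\infty$, of assortative hierarchical stochastic block models $G=G_N$ on the node set $[N]$ with tree $\mathcal{T}$, community probability vector $\pi$ and connection probabilities $p$. Suppose that: (Fixed hierarchy) $\mathcal{T}$ is a rooted binary tree with $K$ leaves, independent of $N$, and $\pi\in(0,1)^K$ is independent of $N$ with $\min_a \pi_a>0$; (Asymptotic scaling) $p(t)=a(t)\,\delta_N$ for every node $t$ of $\mathcal{T}$, where $(a(t))_{t\in\mathcal{T}}$ are positive constants independent of $N$; and that $N\delta_N=\omega(1)$, i.e. $N\delta_N\to\infty$. Let $\mathcal{C}=(C_a)_{a\in\mathcal{L}_{\mathcal{T}}}$ be the true primitive communities and let $\widehat{\mathcal{C}}$ be an estimator of $\mathcal{C}$ with $|\widehat{\mathcal{C}}|=|\mathcal{C}|=K$, possibly correlated with the edges of $G$. If $\widehat{\mathcal{C}}$ is almost exact, then the average-linkage algorithm started from $\widehat{\mathcal{C}}$ recovers $\mathcal{T}$, with probability tending to $1$ as $N\to\infty$.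
   Context: **Tree notation.** $\mathcal{T}$ is a rooted binary tree (each internal node has two children), $\mathcal{L}_{\mathcal{T}}$ is its set of leaves, and $\mathrm{lca}(a,b)$ is the lowest common ancestor of $a$ and $b$. **Hierarchical stochastic block model (HSBM).** Let $\mathcal{T}$ have $K$ leaves, let $\pi=(\pi_a)_{a\in\mathcal{L}_{\mathcal{T}}}$ be a probability vector, and let $p:\mathcal{T}\to[0,1]$ be a function on the nodes of $\mathcal{T}$ that is increasing (assortative): $p(u)<p(v)$ whenever $v$ is a child of $u$. The HSBM is the random undirected graph on $[N]$ (adjacency matrix $A=(A_{ij})$) obtained as follows: each node is independently assigned to a community $C_a$, with $a\in\mathcal{L}_{\mathcal{T}}$ sampled from $\pi$; then, independently over pairs, two nodes $i\in C_a$, $j\in C_b$ are connected with probability $p_{ab}:=p(\mathrm{lca}(a,b))$. **Loss and almost exactness.** For a partition $\widehat{\mathcal{C}}=(\widehat C_1,\dots,\widehat C_K)$ of $[N]$, writing $\mathcal{C}=(C_{\ell_1},\dots,C_{\ell_K})$, set $$\mathrm{loss}(\mathcal{C},\widehat{\mathcal{C}})=\min_{\tau}\sum_{k=1}^K|C_{\ell_k}\,\triangle\,\widehat C_{\tau(k)}|,$$ where the minimum is over permutations $\tau$ of $[K]$ and $\triangle$ is the symmetric difference. The estimator $\widehat{\mathcal{C}}$ is almost exact if $N^{-1}\mathrm{loss}(\mathcal{C},\widehat{\mathcal{C}})\to0$ in probability. **Average-linkage algorithm.** For node sets $V_1,V_2$ let $\rho(V_1,V_2)=\frac{1}{|V_1||V_2|}\sum_{i\in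 V_1}\sum_{j\in V_2}A_{ij}$. Starting from the partition $\widehat{\mathcal{C}}$, as long as at least two clusters remain, choose two distinct current clusters $C,C'$ maximizing $\rho(C,C')$, and replace them by $C\cup C'$. The densities to any other cluster $D$ are updated by $$\rho(C\cup C',D)=\tfrac{|C|}{|C\cup C'|}\rho(C,D)+\tfrac{|C'|}{|C\cup C'|}\rho(C',D).$$ The output is the rooted binary tree $\widehat{\mathcal{T}}$ recording the sequence of nested merges; its leaves are the initial clusters. **Recovery of the tree.** The algorithm recovers $\mathcal{T}$ if, after labelling the initial clusters by the leaves of $\mathcal{T}$ according to a permutation attaining the minimum in the loss, $\widehat{\mathcal{T}}$ equals $\mathcal{T}$ as a leaf-labelled rooted tree (ignoring left/right order of children). *)

(* Defs.v *)
From HB Require Import structures.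
From mathcomp Require Import all_boot all_order all_algebra all_fingroup.
From mathcomp Require Import all_classical all_reals all_analysis.

Set Implicit Arguments.
Unset Strict Implicit.
Unset Printing Implicit Defensive.

Import Order.TTheory GRing.Theory Num.Theory.
Import numFieldNormedType.Exports.

Local Open Scope ring_scope.

Inductive btree (L : Type) : Type :=
  | BLeaf of L
  | BNode of btree L & btree L.

Section BtreeEq.
Variable L : eqType.

Fixpoint btree_encode (t : btree L) : GenTree.tree L :=
  match t with
  | BLeaf a => GenTree.Leaf a
  | BNode l r => GenTree.Node 0 [:: btree_encode l; btree_encode r]
  end.

Fixpoint btree_decode (t : GenTree.tree L) : option (btree L) :=
  match t with
  | GenTree.Leaf a => Some (BLeaf a)
  | GenTree.Node _ [:: l; r] =>
      match btree_decode l, btree_decode r with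
      | Some l', Some r' => Some (BNode l' r')
      | _, _ => None
      end
  | _ => None
  end.

Lemma btree_encodeK : pcancel btree_encode btree_decode.
Proof. by elim=> [//|l /= -> r ->]. Qed.

HB.instance Definition _ := Equality.copy (btree L) (pcan_type btree_encodeK).
End BtreeEq.

Section Trees.
Variable L : eqType.
Implicit Types t u : btree L.

Fixpoint leaves t : seq L :=
  match t with
  | BLeaf a => [:: a]
  | BNode l r => leaves l ++ leaves r
  end.

(* A node is identified with the subtree hanging from it; this is one-to-one
   when the leaf labels are pairwise distinct. *)
Fixpoint nodes t : seq (btree L) :=
  t :: match t with
       | BLeaf _ => [::]
       | BNode l r => nodes l ++ nodes r
       end.

(* For a and b among the leaves of t. *)
Fixpoint lca t (a b : L) : btree L :=
  match t with
  | BLeaf _ => t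
  | BNode l r =>
      if (a \in leaves l) && (b \in leaves l) then lca l a b
      else if (a \in leaves r) && (b \in leaves r) then lca r a b
      else t
  end.

(* Equality of leaf-labelled rooted trees, up to exchanging the two children
   of any node. *)
Fixpoint same_tree t u : bool :=
  match t, u with
  | BLeaf a, BLeaf b => a == b
  | BNode l r, BNode l' r' =>
      (same_tree l l' && same_tree r r') || (same_tree l r' && same_tree r l')
  | _, _ => false
  end.

End Trees.

Fixpoint map_btree (L M : Type) (f : L -> M) (t : btree L) : btree M :=
  match t with
  | BLeaf a => BLeaf (f a)
  | BNode l r => BNode (map_btree f l) (map_btree f r)
  end.

(* The leaf set of a tree with K leaves is taken to be 'I_K: every element of
   'I_K labels exactly one leaf. *)
Definition leaf_labelled (K : nat) (T : btree 'I_K) : bool :=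
  perm_eq (leaves T) (enum 'I_K).

Definition assortative (R : realType) (K : nat) (T : btree 'I_K)
    (p : btree 'I_K -> R) : Prop :=
  forall l r : btree 'I_K, BNode l r \in nodes T ->
    p (BNode l r) < p l /\ p (BNode l r) < p r.

Section HSBM.
Variables (R : realType) (K : nat) (T : btree 'I_K).
Variables (pi : 'I_K -> R) (p : btree 'I_K -> R) (N : nat).

(* Probability that the community labels are z and the adjacency matrix is g;
   loops are excluded. *)
Definition hsbm_pmf (z : {ffun 'I_N -> 'I_K}) (g : 'M[bool]_N) : R :=
  if (g^T == g) && [forall i, ~~ g i i] then
    (\prod_(i < N) pi (z i)) *
    (\prod_(i < N) \prod_(j < N | (i < j)%N)
       (if g i j then p (lca T (z i) (z j)) else 1 - p (lca T (z i) (z j))))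
  else 0.

End HSBM.

(* Measurability of a random element of a finite type. *)
Definition finite_rv (d : measure_display) (Om : measurableType d)
    (F : finType) (X : Om -> F) : Prop :=
  forall x : F, measurable [set w | X w = x]%classic.

Definition is_hsbm (d : measure_display) (Om : measurableType d)
    (R : realType) (P : probability Om R) (K : nat) (T : btree 'I_K)
    (pi : 'I_K -> R) (p : btree 'I_K -> R) (N : nat)
    (Z : Om -> {ffun 'I_N -> 'I_K}) (A : Om -> 'M[bool]_N) : Prop :=
  [/\ finite_rv Z, finite_rv A &
      forall z g, P [set w | Z w = z /\ A w = g]%classic = (hsbm_pmf T pi p z g)%:E].

Definition communities (K N : nat) (z : {ffun 'I_N -> 'I_K}) :
    {ffun 'I_K -> {set 'I_N}} :=
  [ffun k => [set i | z i == k]%SET].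

(* Parts are allowed to be empty (unavoidable when N < K). *)
Definition ordered_partition (K N : nat) (C : {ffun 'I_K -> {set 'I_N}}) :
    Prop :=
  (forall k l, k != l -> [disjoint C k & C l]) /\
  (\bigcup_(k < K) C k)%SET = [set: 'I_N]%SET.

Definition symdiff (F : finType) (X Y : {set F}) : {set F} :=
  (X :\: Y) :|: (Y :\: X).

Section Loss.
Variables K N : nat.
Implicit Types C Ch : {ffun 'I_K -> {set 'I_N}}.

Definition mismatch C Ch (tau : 'S_K) : nat :=
  \sum_(k < K) #|symdiff (C k) (Ch (tau k))|.

Definition loss C Ch : nat :=
  mismatch C Ch [arg min_(tau < 1%g) mismatch C Ch tau]%N.

End Loss.

(* The spaces Om N carry the graph, the communities and the estimator, and may
   change with N. *)
Definition almost_exact (R : realType) (d : nat -> measure_display)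
    (Om : forall N, measurableType (d N)) (P : forall N, probability (Om N) R)
    (K : nat) (C Ch : forall N, Om N -> {ffun 'I_K -> {set 'I_N}}) : Prop :=
  forall eps : R, 0 < eps ->
    (P N [set w | eps < N%:R^-1 * (loss (C N w) (Ch N w))%:R]
      @[N --> \oo] --> 0%E)%classic.

Section AverageLinkage.
Variables (R : realType) (K N : nat) (A : 'M[bool]_N).

(* Equal to 0 if V1 or V2 is empty. *)
Definition density (V1 V2 : {set 'I_N}) : R :=
  (#|V1|%:R * #|V2|%:R)^-1 * \sum_(i in V1) \sum_(j in V2) (A i j)%:R.

Lemma density_setU (C C' D : {set 'I_N}) : [disjoint C & C'] ->
  density (C :|: C') D =
    #|C|%:R / #|C :|: C'|%:R * density C D +
    #|C'|%:R / #|C :|: C'|%:R * density C' D.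
Proof.
move=> dCC; rewrite /density.
rewrite (eq_bigl [predU C & C']) => [|i]; last by rewrite !inE.
rewrite bigU //=.
have E (V : {set 'I_N}) (u : R) :
    #|V|%:R / u * ((#|V|%:R * #|D|%:R)^-1 *
      \sum_(i in V) \sum_(j in D) (A i j)%:R) =
    (u * #|D|%:R)^-1 * \sum_(i in V) \sum_(j in D) (A i j)%:R :> R.
  have [->|V0] := eqVneq V finset.set0; first by rewrite big_set0 !mulr0.
  have nz : #|V|%:R != 0 :> R by rewrite pnatr_eq0 cards_eq0.
  by rewrite mulrA !invfM mulrACA divff // mul1r.
by rewrite !E -mulrDr.
Qed.

Variable Ch : {ffun 'I_K -> {set 'I_N}}.

Definition node_set (t : btree 'I_K) : {set 'I_N} :=
  (\bigcup_(k <- leaves t) Ch k)%SET.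

Definition link (s : seq (btree 'I_K)) (u v : btree 'I_K) : Prop :=
  [/\ u \in s, v \in s, u != v &
      forall u' v', u' \in s -> v' \in s -> u' != v' ->
        density (node_set u') (node_set v') <= density (node_set u) (node_set v)].

(* [linkage s t]: t is an output of the algorithm from the current clusters s,
   each given by the tree of its past merges. Ties may be broken in any way,
   so there can be several outputs. Densities are recomputed from A, which by
   [density_setU] agrees with updating them by weighted averages. *)
Inductive linkage : seq (btree 'I_K) -> btree 'I_K -> Prop :=
  | linkage_stop t : linkage [:: t] t
  | linkage_merge s u v t : link s u v ->
      linkage (BNode u v :: rem u (rem v s)) t -> linkage s t.

Definition average_linkage : btree 'I_K -> Prop :=
  linkage [seq BLeaf k | k <- enum 'I_K].

(* Uniform over the choice of the optimal permutation and over ties. As tau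
   matches C k with Ch (tau k), the initial cluster k is labelled tau^-1 k. *)
Definition recovers (T : btree 'I_K) (C : {ffun 'I_K -> {set 'I_N}}) : Prop :=
  forall (tau : 'S_K) (t : btree 'I_K),
    mismatch C Ch tau = loss C Ch -> average_linkage t ->
    same_tree (map_btree (tau^-1)%g t) T.

End AverageLinkage.

(* Main.v *)
(* Two disjoint subtrees u, v of T have the same lowest common ancestor w for all
   pairs of their leaves, so the density between the corresponding unions of
   communities is close to p(w).  If the current clusters form a cut of T and the
   densest pair u, v were not the two children of w, another cluster would lie
   strictly below w together with u or v, hence at a density close to at least
   p(child of w) > p(w).  So every merge creates a subtree of T.

   Uniformity over estimators correlated with the graph comes from the residuals
   Y_ib = sum over j in C_b, j <> i, of (A_ij - p_ij).  Their total absolute value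
   S is at most eta N^2 delta with high probability, since
   E (sum_ib Y_ib^2) <= N^2 max(p) and N delta -> oo.  S controls both the edge
   counts between true communities and, for every set M of nodes, the number of
   edges touching M, which is at most |M| N max(p) + S.  With M the misclassified
   nodes, all the densities used by the algorithm are within o(delta) of p(w). *)
Require Import Defs.
From HB Require Import structures.
From mathcomp Require Import all_boot all_order all_algebra all_fingroup.
From mathcomp Require Import all_classical all_reals all_analysis.
From mathcomp Require Import ring lra.
Import Order.TTheory GRing.Theory Num.Theory.
Import numFieldNormedType.Exports.
Local Open Scope classical_set_scope.
Local Open Scope ring_scope.

(** * Subtrees and lowest common ancestors *)

Section TreeFacts.
Context {L : eqType}.
Implicit Types t u v n m l r w : btree L.

Lemma nodes_refl t : t \in nodes t.
Proof. by case: t => *; rewrite inE eqxx. Qed.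

Lemma nodesBNode l r u :
  (u \in nodes (BNode l r)) = [|| u == BNode l r, u \in nodes l | u \in nodes r].
Proof. by rewrite /= inE mem_cat. Qed.

Lemma nodes_trans u t v : u \in nodes t -> v \in nodes u -> v \in nodes t.
Proof.
elim: t => [a|l IHl r IHr] /=; first by rewrite inE => /eqP ->.
rewrite inE mem_cat => /or3P[/eqP ->//|ul|ur] vu.
  by rewrite inE mem_cat IHl// orbT.
by rewrite inE mem_cat IHr// !orbT.
Qed.

Lemma leaves_nodes u t : u \in nodes t -> {subset leaves u <= leaves t}.
Proof.
elim: t => [a|l IHl r IHr] /=; first by rewrite inE => /eqP ->.
rewrite inE mem_cat => /or3P[/eqP ->//|/IHl ul|/IHr ur] x xu; rewrite mem_cat.
  by rewrite ul.
by rewrite ur ?orbT.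
Qed.

Lemma uniq_leaves_node u t : u \in nodes t -> uniq (leaves t) -> uniq (leaves u).
Proof.
elim: t => [a|l IHl r IHr] /=; first by rewrite inE => /eqP ->.
rewrite inE mem_cat cat_uniq => /or3P[/eqP ->/=|/IHl ul|/IHr ur] /and3P[? ? ?].
- by rewrite cat_uniq; apply/and3P.
- exact: ul.
- exact: ur.
Qed.

Lemma leaves_exists t : exists a, a \in leaves t.
Proof.
elim: t => [a|l [a al] r _]; first by exists a; rewrite inE eqxx.
by exists a; rewrite mem_cat al.
Qed.

Lemma uniq_leaves_lr {l r} : uniq (leaves (BNode l r)) ->
  forall {a}, a \in leaves l -> a \in leaves r -> False.
Proof.
rewrite /= cat_uniq => /and3P[_ /hasPn h _] a al /h.
by rewrite /= al.
Qed.

(** Distinct labels make the leaf sets of the two children of a node disjoint, so nodes sharing a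
    leaf descend into the same child until one of them is the root of the remaining subtree. *)
Lemma nodes_laminar t n m a : uniq (leaves t) ->
  n \in nodes t -> m \in nodes t -> a \in leaves n -> a \in leaves m ->
  n \in nodes m \/ m \in nodes n.
Proof.
elim: t => [b|l IHl r IHr] ut.
  by rewrite !inE => /eqP -> /eqP -> _ _; left; apply: nodes_refl.
have /= := ut; rewrite cat_uniq => /and3P[ul _ ur].
rewrite !nodesBNode => /or3P[/eqP ->|nl|nr] /or3P[/eqP ->|ml|mr] an am.
- by left; apply: nodes_refl.
- by right; rewrite nodesBNode ml orbT.
- by right; rewrite nodesBNode mr !orbT.
- by left; rewrite nodesBNode nl orbT.
- exact: IHl.
- by case: (uniq_leaves_lr ut (leaves_nodes _ _ nl _ an) (leaves_nodes _ _ mr _ am)).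
- by left; rewrite nodesBNode nr !orbT.
- by case: (uniq_leaves_lr ut (leaves_nodes _ _ ml _ am) (leaves_nodes _ _ nr _ an)).
- exact: IHr.
Qed.

Lemma lcaC t a b : lca t a b = lca t b a.
Proof.
elim: t => //= l -> r ->.
by rewrite andbC [(a \in leaves r) && _]andbC.
Qed.

Lemma lca_nodes t a b : lca t a b \in nodes t.
Proof.
elim: t => [c|l IHl r IHr] /=; first by rewrite inE.
case: ifP => _; first by rewrite inE mem_cat IHl orbT.
case: ifP => _; first by rewrite inE mem_cat IHr !orbT.
by rewrite inE eqxx.
Qed.

Lemma lca_split t a b : uniq (leaves t) -> a \in leaves t -> b \in leaves t ->
  a != b -> exists l r, lca t a b = BNode l r /\
    ((a \in leaves l /\ b \in leaves r) \/ (a \in leaves r /\ b \in leaves l)).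
Proof.
elim: t => [c|l IHl r IHr] ut.
  by rewrite !inE => /eqP -> /eqP ->; rewrite eqxx.
have /= := ut; rewrite cat_uniq => /and3P[ul _ ur].
rewrite !mem_cat => /orP[al|ar] /orP[bl|br] ab.
- by rewrite al bl; apply: IHl.
- have /negP/negPf -> := fun h => uniq_leaves_lr ut h br.
  have /negP/negPf -> := fun h => uniq_leaves_lr ut al h.
  by rewrite andbF; exists l, r; split => //; left.
- have /negP/negPf -> := fun h => uniq_leaves_lr ut h ar.
  have /negP/negPf -> := fun h => uniq_leaves_lr ut bl h.
  by rewrite andbF; exists l, r; split => //; right.
- have /negP/negPf -> := fun h => uniq_leaves_lr ut h br.
  by rewrite andbF ar br; apply: IHr.
Qed.

Lemma lca_node t n a b : uniq (leaves t) -> n \in nodes t ->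
  a \in leaves n -> b \in leaves n -> lca t a b = lca n a b.
Proof.
elim: t => [c|l IHl r IHr] ut; first by rewrite !inE => /eqP ->.
have /= := ut; rewrite cat_uniq => /and3P[ul _ ur].
rewrite inE mem_cat => /or3P[/eqP ->//|nl|nr] an bn.
  by rewrite !(leaves_nodes _ _ nl)//=; apply: IHl.
have /negP/negPf -> := fun h => uniq_leaves_lr ut h (leaves_nodes _ _ nr _ bn).
by rewrite andbF !(leaves_nodes _ _ nr)//=; apply: IHr.
Qed.

(** Two disjoint nodes stay in the same child until the node that separates them, so [lca] takes the
    same branches for every pair of leaves. This makes the target density of a pair of clusters well
    defined. *)
Lemma lca_disjoint_nodes t n m a b a' b' : uniq (leaves t) ->
  n \in nodes t -> m \in nodes t ->
  (forall x, x \in leaves n -> x \in leaves m -> False) ->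
  a \in leaves n -> b \in leaves m -> a' \in leaves n -> b' \in leaves m ->
  lca t a b = lca t a' b'.
Proof.
elim: t => [c|l IHl r IHr] ut nt mt nm an bm an' bm'; first by [].
have [nT mT] : n != BNode l r /\ m != BNode l r.
  split; apply/eqP => E; subst.
    by apply: (nm b) => //; apply: (leaves_nodes _ _ mt).
  by apply: (nm a) => //; apply: (leaves_nodes _ _ nt).
have /= := ut; rewrite cat_uniq => /and3P[ul _ ur].
move: nt mt; rewrite !nodesBNode (negPf nT) (negPf mT) /=.
move=> /orP[nl|nr] /orP[ml|mr].
- rewrite !(leaves_nodes _ _ nl a, leaves_nodes _ _ nl a')//.
  by rewrite !(leaves_nodes _ _ ml b, leaves_nodes _ _ ml b')//=; apply: IHl.
- rewrite !(leaves_nodes _ _ nl a, leaves_nodes _ _ nl a')//.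
  have F x (xm : x \in leaves m) : (x \in leaves l) = false.
    by apply/negP => h; apply: (uniq_leaves_lr ut h); apply: (leaves_nodes _ _ mr).
  have G x (xn : x \in leaves n) : (x \in leaves r) = false.
    by apply/negP => h; apply: (uniq_leaves_lr ut _ h); apply: (leaves_nodes _ _ nl).
  by rewrite !(F b)// !(F b')// !(G a)// !(G a')// !andbF.
- have F x (xm : x \in leaves m) : (x \in leaves r) = false.
    by apply/negP => h; apply: (uniq_leaves_lr ut _ h); apply: (leaves_nodes _ _ ml).
  have G x (xn : x \in leaves n) : (x \in leaves l) = false.
    by apply/negP => h; apply: (uniq_leaves_lr ut h); apply: (leaves_nodes _ _ nr).
  by rewrite !(G a)// !(G a')// !(F b)// !(F b')// !andbF.
- have F x (xm : x \in leaves m) : (x \in leaves l) = false.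
    by apply/negP => h; apply: (uniq_leaves_lr ut h); apply: (leaves_nodes _ _ mr).
  rewrite !(F b)// !(F b')// !andbF.
  rewrite !(leaves_nodes _ _ nr a, leaves_nodes _ _ nr a')//.
  by rewrite !(leaves_nodes _ _ mr b, leaves_nodes _ _ mr b')//=; apply: IHr.
Qed.

Lemma same_tree_leaves t u : same_tree t u -> perm_eq (leaves t) (leaves u).
Proof.
elim: t u => [a|l IHl r IHr] [b|l' r'] //=; first by move=> /eqP ->.
move=> /orP[] /andP[/IHl hl /IHr hr]; first exact: perm_cat.
by rewrite perm_catC perm_cat.
Qed.

Lemma leaves_map (M : eqType) (f : L -> M) t :
  leaves (map_btree f t) = map f (leaves t).
Proof. by elim: t => //= l -> r ->; rewrite map_cat. Qed.

Lemma node_full t n : uniq (leaves t) -> n \in nodes t ->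
  {subset leaves t <= leaves n} -> n = t.
Proof.
case: t => [a|l r] ut; first by rewrite inE => /eqP.
rewrite nodesBNode => /or3P[/eqP//|nl|nr] sub.
  have [a ar] := leaves_exists r.
  case: (uniq_leaves_lr ut _ ar); apply: (leaves_nodes _ _ nl); apply: sub.
  by rewrite mem_cat ar orbT.
have [a al] := leaves_exists l.
case: (uniq_leaves_lr ut al); apply: (leaves_nodes _ _ nr); apply: sub.
by rewrite mem_cat al.
Qed.

(** The leaf [a] makes [n] comparable with [BNode l r], and [b], which lies in that node but not in
    [n], forces [n] strictly below it. The two implications cover both orientations of the
    children. *)
Lemma disjoint_node_child t n m l r a b : uniq (leaves t) ->
  n \in nodes t -> BNode l r \in nodes t ->
  (forall x, x \in leaves n -> x \in leaves m -> False) ->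
  a \in leaves n -> b \in leaves m ->
  a \in leaves l /\ b \in leaves r \/ a \in leaves r /\ b \in leaves l ->
  (a \in leaves l -> n \in nodes l) /\ (a \in leaves r -> n \in nodes r).
Proof.
move=> ut nt wt nm an bm ab.
have uw := uniq_leaves_node _ _ wt ut.
have [aw bw] : a \in leaves (BNode l r) /\ b \in leaves (BNode l r).
  by rewrite /= !mem_cat; case: ab => -[-> ->]; rewrite ?orbT.
have : n \in nodes (BNode l r).
  case: (nodes_laminar t n _ a ut nt wt an aw) => // wn.
  by case: (nm b) => //; apply: (leaves_nodes _ _ wn).
rewrite nodesBNode => /or3P[/eqP nE|nl|nr].
- by case: (nm b) => //; rewrite nE.
- split=> // ar; case: (uniq_leaves_lr uw _ ar); exact: (leaves_nodes _ _ nl).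
- split=> // al; case: (uniq_leaves_lr uw al); exact: (leaves_nodes _ _ nr).
Qed.

End TreeFacts.

Lemma assortative_nodes {R : realType} {K : nat} (T : btree 'I_K) (p : btree 'I_K -> R) n m :
  assortative T p -> n \in nodes T -> m \in nodes n -> p n <= p m.
Proof.
move=> pT; elim: n => [a|l IHl r IHr] nT; first by rewrite inE => /eqP ->.
have [pl pr] := pT _ _ nT.
rewrite nodesBNode => /or3P[/eqP ->//|ml|mr].
  apply: (le_trans (ltW pl)); apply: IHl => //; apply: (nodes_trans _ _ _ nT).
  by rewrite nodesBNode nodes_refl orbT.
apply: (le_trans (ltW pr)); apply: IHr => //; apply: (nodes_trans _ _ _ nT).
by rewrite nodesBNode nodes_refl !orbT.
Qed.

(** * Merging with accurate densities *)

Section LinkageFacts.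
Context {R : realType} {K N : nat} {g : 'M[bool]_N} {Ch : {ffun 'I_K -> {set 'I_N}}}.
Context {T : btree 'I_K} (T_leaves : leaf_labelled T) (p : btree 'I_K -> R) (e : R).
Context (f : 'I_K -> 'I_K) (f_inj : injective f).
Hypothesis p_assort : assortative T p.
(** Twice the error: densities known up to [e] still separate a node from its children. *)
Hypothesis p_gap : forall l r, BNode l r \in nodes T ->
  p (BNode l r) + e *+ 2 <= p l /\ p (BNode l r) + e *+ 2 <= p r.
(** Accuracy is asked of all pairs of disjoint subtrees, not only of those met in one run, so the
    analysis of the merges is deterministic and covers every way of breaking ties. *)
Hypothesis density_close : forall x y n m a b,
  n \in nodes T -> m \in nodes T ->
  same_tree (map_btree f x) n -> same_tree (map_btree f y) m ->
  (forall c, c \in leaves n -> c \in leaves m -> False) ->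
  a \in leaves n -> b \in leaves m ->
  `|density R g (node_set Ch x) (node_set Ch y) - p (lca T a b)| < e.

Let matches (u n : btree 'I_K) := n \in nodes T /\ same_tree (map_btree f u) n.

(* Up to the relabelling [f], the current clusters form a cut of [T]. *)
Let is_cut (s : seq (btree 'I_K)) :=
  (forall u, u \in s -> exists n, matches u n) /\
  perm_eq (flatten [seq leaves u | u <- s]) (enum 'I_K).

Let uT : uniq (leaves T).
Proof. by rewrite (perm_uniq T_leaves) enum_uniq. Qed.

Let memT a : a \in leaves T.
Proof. by rewrite (perm_mem T_leaves) mem_enum. Qed.

Lemma matches_mem u n y : matches u n -> (f y \in leaves n) = (y \in leaves u).
Proof.
move=> [_ /same_tree_leaves /perm_mem <-]; rewrite leaves_map.
by rewrite mem_map.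
Qed.

Lemma cut_disjoint s u v y : is_cut s -> u \in s -> v \in s ->
  y \in leaves u -> y \in leaves v -> u = v.
Proof.
move=> [_ pe] us vs yu yv; apply/eqP/negPn/negP => uv.
have := pe; rewrite (permPl (perm_flatten (perm_map (@leaves _) (perm_to_rem us)))).
move/perm_uniq; rewrite enum_uniq /= cat_uniq => /and3P[_ /hasPn h _].
have /h : y \in flatten [seq leaves i | i <- rem u s].
  apply/flattenP; exists (leaves v) => //; apply: map_f.
  by have := vs; rewrite (perm_mem (perm_to_rem us)) inE eq_sym (negPf uv).
by rewrite /= yu.
Qed.

Lemma cut_matches_disjoint s u v n m : is_cut s -> u \in s -> v \in s -> u != v ->
  matches u n -> matches v m -> forall c, c \in leaves n -> c \in leaves m -> False.
Proof.
move=> cs us vs uv un vm c.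
have [h fK hK] := injF_bij f_inj; rewrite -(hK c).
rewrite (matches_mem _ _ _ un) (matches_mem _ _ _ vm) => cu cv.
by move/eqP: uv; apply; apply: (cut_disjoint s u v (h c)).
Qed.

(** If [n] missed a leaf [x] of [c], the cluster carrying [x] would have its common ancestors with
    [a] inside [c], hence a density with [u] above [p c - e >= w + e > d], against maximality. In
    use, [w] is the value of [p] at the parent of [c] and [d] the density of the merged pair. *)
Lemma cut_child s u n a c w d : is_cut s -> u \in s -> matches u n ->
  a \in leaves n -> n \in nodes c -> c \in nodes T ->
  w + e *+ 2 <= p c -> d < w + e ->
  (forall v, v \in s -> u != v ->
     density R g (node_set Ch u) (node_set Ch v) <= d) -> n = c.
Proof.
move=> cs us un an nc cT wc dw dmax.
have uc := uniq_leaves_node _ _ cT uT.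
apply: node_full => // x xc; apply/negPn/negP => xn.
have [h fK hK] := injF_bij f_inj.
have [] := cs => hs pe.
have : h x \in flatten [seq leaves u | u <- s] by rewrite (perm_mem pe) mem_enum.
case/flattenP => _ /mapP[v vs ->] hv.
have uv : u != v.
  by apply: contraNneq xn => E; rewrite -E in hv; rewrite -(hK x) (matches_mem _ _ _ un).
have [m vm] := hs _ vs.
have xm : x \in leaves m by rewrite -(hK x) (matches_mem _ _ _ vm).
have dnm := cut_matches_disjoint _ _ _ _ _ cs us vs uv un vm.
have [[nT un'] [mT vm']] := (un, vm).
have := density_close _ _ _ _ _ _ nT mT un' vm' dnm an xm.
have lc : lca T a x \in nodes c.
  by rewrite (lca_node T c)//; [exact: lca_nodes|apply: (leaves_nodes _ _ nc)].
have := assortative_nodes _ _ _ _ p_assort cT lc.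
have := dmax v vs uv.
rewrite ltr_norml => ? ? /andP[? ?].
have : e *+ 2 = e + e by rewrite mulr2n.
lra.
Qed.

Lemma density_lt u v n m a b : matches u n -> matches v m ->
  (forall c, c \in leaves n -> c \in leaves m -> False) ->
  a \in leaves n -> b \in leaves m ->
  density R g (node_set Ch u) (node_set Ch v) < p (lca T a b) + e.
Proof.
move=> [nT un] [mT vm] nm an bm.
have := density_close _ _ _ _ _ _ nT mT un vm nm an bm.
by rewrite ltr_norml => /andP[? ?]; lra.
Qed.

(** The maximal density is less than [e] above the value of [p] at the node separating the two
    clusters. [cut_child], applied on either side, then forces the clusters to fill the two children
    of that node. *)
Lemma link_siblings s u v : is_cut s -> link R g Ch s u v ->
  exists n, matches (BNode u v) n.
Proof.
move=> cs [us vs uv dmax].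
have [n un] := cs.1 _ us; have [m vm] := cs.1 _ vs.
have nm := cut_matches_disjoint _ _ _ _ _ cs us vs uv un vm.
have mn c : c \in leaves m -> c \in leaves n -> False by move=> h1 h2; exact: nm h2 h1.
have [a an] := leaves_exists n; have [b bm] := leaves_exists m.
have ab : a != b by apply/eqP => E; apply: (nm a) => //; rewrite E.
have [l [r [lE lr]]] := lca_split T a b uT (memT a) (memT b) ab.
have wT : BNode l r \in nodes T by rewrite -lE; apply: lca_nodes.
have lT : l \in nodes T by apply: (nodes_trans _ _ _ wT); rewrite nodesBNode nodes_refl orbT.
have rT : r \in nodes T by apply: (nodes_trans _ _ _ wT); rewrite nodesBNode nodes_refl !orbT.
have duv := density_lt _ _ _ _ _ _ un vm nm an bm.
rewrite lE in duv.
have [gl gr] := p_gap _ _ wT.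
have [nl nr] := disjoint_node_child T n m l r a b uT un.1 wT nm an bm lr.
have lr' : b \in leaves l /\ a \in leaves r \/ b \in leaves r /\ a \in leaves l.
  by case: lr => -[? ?]; [right|left].
have [ml mr] := disjoint_node_child T m n l r b a uT vm.1 wT mn bm an lr'.
have un' c : n \in nodes c -> c \in nodes T -> p (BNode l r) + e *+ 2 <= p c -> n = c.
  move=> nc cT gc; apply: (cut_child s u n a c _ _ cs us un an nc cT gc duv).
  by move=> v' v's uv'; apply: dmax.
have vm' c : m \in nodes c -> c \in nodes T -> p (BNode l r) + e *+ 2 <= p c -> m = c.
  move=> nc cT gc; apply: (cut_child s v m b c _ _ cs vs vm bm nc cT gc duv).
  by move=> v' v's uv'; apply: dmax.
exists (BNode l r); split=> //=.
case: lr => -[ca cb].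
  by rewrite -(un' l)// ?nl// -(vm' r) ?mr// un.2 vm.2.
by rewrite -(un' r)// ?nr// -(vm' l) ?ml// un.2 vm.2 orbT.
Qed.

Lemma cut_merge s u v : is_cut s -> link R g Ch s u v ->
  is_cut (BNode u v :: rem u (rem v s)).
Proof.
move=> cs luv; have [us vs uv _] := luv; split=> [w|].
  rewrite inE => /orP[/eqP ->|/mem_rem /mem_rem /cs.1//].
  exact: link_siblings luv.
rewrite -(permPr cs.2) /= perm_sym.
have uvs : u \in rem v s.
  by have := us; rewrite (perm_mem (perm_to_rem vs)) inE (negPf uv).
rewrite (permPl (perm_flatten (perm_map (@leaves _) (perm_to_rem vs)))) /=.
rewrite -catA perm_sym perm_catCA perm_cat2l perm_sym.
exact: (perm_flatten (perm_map (@leaves _) (perm_to_rem uvs))).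
Qed.

(** Being a cut is the invariant of the run. At the end a single cluster carries all the leaves, and
    the only node of [T] doing so is [T] itself. *)
Lemma linkage_correct s t : is_cut s -> linkage R g Ch s t ->
  same_tree (map_btree f t) T.
Proof.
move=> + lst; elim: lst => [{}t|{}s u v {}t luv _ IH] cs; last exact/IH/cut_merge.
have [n tn] := cs.1 t (mem_head _ _).
suff <- : n = T by exact: tn.2.
apply: node_full => //; first exact: tn.1.
have [h fK hK] := injF_bij f_inj.
move=> x _; rewrite -(hK x) (matches_mem _ _ _ tn).
by have := perm_mem cs.2 (h x); rewrite /= cats0 mem_enum => ->.
Qed.

Lemma average_linkage_correct t : average_linkage R g Ch t ->
  same_tree (map_btree f t) T.
Proof.
apply: linkage_correct; split=> [_ /mapP[k _ ->]|].
  exists (BLeaf (f k)); split=> //=.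
  elim: (T) (memT (f k)) => [c|l IHl r IHr]; first by rewrite !inE => /eqP ->.
  by rewrite nodesBNode /= mem_cat => /orP[/IHl ->|/IHr ->]; rewrite ?orbT.
by rewrite -map_comp (eq_map (g := fun k => [:: k]))// flatten_seq1.
Qed.

End LinkageFacts.

(** * Edge counts between perturbed communities *)

(** Centered degree of [i] towards community [b]. The index [j = i] is left out because there are no
    loops: its term would be the constant [- q (z i) (z i)], which need not be centered. *)
Definition resid {R : realType} {K N : nat} (q : 'I_K -> 'I_K -> R)
    (z : {ffun 'I_N -> 'I_K}) (g : 'M[bool]_N) (i : 'I_N) (b : 'I_K) : R :=
  \sum_(j | (j != i) && (z j == b)) ((g i j)%:R - q (z i) (z j)).

Definition total_resid {R : realType} {K N : nat} (q : 'I_K -> 'I_K -> R)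
    (z : {ffun 'I_N -> 'I_K}) (g : 'M[bool]_N) : R :=
  \sum_i \sum_b `|resid q z g i b|.

Definition simple_graph {N : nat} (g : 'M[bool]_N) : bool :=
  (g^T == g) && [forall i, ~~ g i i].

Section BlockSums.
Context {R : realType} {K N : nat} (q : 'I_K -> 'I_K -> R) (qm : R).
Context (z : {ffun 'I_N -> 'I_K}) (g : 'M[bool]_N).
Hypothesis g_simple : simple_graph g.
Hypothesis q_bound : forall a b, 0 <= q a b <= qm.

Lemma simple_graphC i j : g i j = g j i.
Proof. by have /andP[/eqP gT _] := g_simple; rewrite -[in LHS]gT mxE. Qed.

Lemma simple_graph_loop i : g i i = false.
Proof. by have /andP[_ /forallP /(_ i) /negPf] := g_simple. Qed.

Lemma sum_resid (i : 'I_N) :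
  \sum_b resid q z g i b = \sum_(j | j != i) ((g i j)%:R - q (z i) (z j)).
Proof. by rewrite /resid [RHS](partition_big z predT). Qed.

Lemma degree_le i :
  \sum_j (g i j)%:R <= \sum_b `|resid q z g i b| + N%:R * qm.
Proof.
rewrite (bigD1 i)//= simple_graph_loop add0r.
rewrite (eq_bigr (fun j => (g i j)%:R - q (z i) (z j) + q (z i) (z j))); last first.
  by move=> j _; rewrite subrK.
rewrite big_split/= -sum_resid lerD//.
  by apply: ler_sum => b _; apply: ler_norm.
apply: (@le_trans _ _ (\sum_(j < N) qm)); last first.
  by rewrite sumr_const card_ord mulr_natl.
rewrite [leRHS](bigD1 i)//= -[leLHS]add0r lerD//.
  by have /andP[q0 qqm] := q_bound (z i) (z i); apply: le_trans qqm.
by apply: ler_sum => j _; have /andP[] := q_bound (z i) (z j).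
Qed.

(** The bound holds for all [M] at once, so [M] may depend on the graph. The extra [qm] per pair
    pays for the centering [theta] in [g i j - theta]. *)
Lemma sum_degree_le (M : {set 'I_N}) :
  \sum_(i in M) \sum_j ((g i j)%:R + qm) <=
  total_resid q z g + (#|M|%:R * N%:R * qm) *+ 2.
Proof.
apply: (@le_trans _ _
  (\sum_(i in M) (\sum_b `|resid q z g i b| + (N%:R * qm) *+ 2))).
  apply: ler_sum => i _; rewrite big_split /= sumr_const card_ord.
  by rewrite -[qm *+ N]mulr_natl mulr2n addrA lerD2r degree_le.
rewrite big_split/= lerD//.
  rewrite /total_resid [leRHS](bigID (mem M))/= lerDl.
  by apply: sumr_ge0 => i _; apply: sumr_ge0 => b _.
by rewrite sumr_const -mulrnA mulnC mulrnA -[_ *+ #|M|]mulr_natl mulrA.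
Qed.

(** As [q] is constant on the block, the row of [i] splits over [b] in [V] into residuals of [i],
    each counted once in [total_resid]. *)
Lemma community_block_sum_le (U V : {set 'I_K}) (theta : R) :
  (forall a, a \in U -> a \in V -> False) -> (forall a b, a \in U -> b \in V -> q a b = theta) ->
  `|\sum_(i | z i \in U) \sum_(j | z j \in V) ((g i j)%:R - theta)| <=
  total_resid q z g.
Proof.
move=> dUV qUV; apply: (le_trans (ler_norm_sum _ _ _)).
rewrite /total_resid [leRHS](bigID (fun i => z i \in U))/=.
rewrite -[leLHS]addr0; apply: lerD; last first.
  by apply: sumr_ge0 => i _; apply: sumr_ge0 => b _.
apply: ler_sum => i ziU.
rewrite (partition_big z (mem V))//=.
apply: (le_trans (ler_norm_sum _ _ _)).
rewrite [leRHS](bigID (mem V))/= -[leLHS]addr0; apply: lerD; last exact: sumr_ge0.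
apply: ler_sum => b bV; rewrite le_eqVlt; apply/orP; left; apply/eqP.
congr `|_|; rewrite /resid; apply: eq_big => j.
  have [jb|] := eqVneq (z j) b; rewrite ?andbF// andbT jb bV ?eqxx ?andbT.
  (* Disjointness of [U] and [V] keeps the diagonal out of the block, in agreement with the
     condition [j != i] in [resid]. *)
  by apply/esym/eqP => ji; apply: (dUV b) => //; rewrite -jb ji.
by move=> /andP[zjV _]; rewrite (qUV _ _ ziU zjV).
Qed.

(** One [total_resid] comes from the true communities. Passing to [DU] and [DV] alters only the rows
    in [MU] and the columns in [MV], and each of these two degree sums costs another [total_resid]
    plus twice [m * N * qm]. *)
Lemma block_sum_le (U V : {set 'I_K}) (DU DV : {set 'I_N}) (m theta : R) :
  (forall a, a \in U -> a \in V -> False) -> 0 <= theta <= qm ->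
  (forall a b, a \in U -> b \in V -> q a b = theta) ->
  #|symdiff [set i | z i \in U]%SET DU|%:R <= m ->
  #|symdiff [set i | z i \in V]%SET DV|%:R <= m ->
  `|\sum_(i in DU) \sum_(j in DV) ((g i j)%:R - theta)| <=
  total_resid q z g *+ 3 + (m * N%:R * qm) *+ 4.
Proof.
move=> dUV /andP[theta0 theta_qm] qUV mU mV.
set MU := symdiff _ DU in mU *; set MV := symdiff _ DV in mV *.
pose w i j : R := (g i j)%:R - theta.
have wle i j : `|w i j| <= (g i j)%:R + qm.
  rewrite /w (le_trans (ler_normB _ _))// lerD//.
    by rewrite ger0_norm// ler0n.
  by rewrite ger0_norm.
have sumE (X Y : pred 'I_N) : \sum_(i | X i) \sum_(j | Y j) w i j =
    \sum_i \sum_j (X i && Y j)%:R * w i j.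
  rewrite big_mkcond; apply: eq_bigr => i _; rewrite big_mkcond /=.
  case: (X i) => /=; last by rewrite big1// => j _; rewrite mul0r.
  by apply: eq_bigr => j _; case: (Y j); rewrite ?mul1r ?mul0r.
have -> : \sum_(i in DU) \sum_(j in DV) w i j =
    \sum_(i | z i \in U) \sum_(j | z j \in V) w i j +
    \sum_i \sum_j ((((i \in DU) && (j \in DV))%:R -
                    ((z i \in U) && (z j \in V))%:R) * w i j).
  rewrite !sumE -big_split/=; apply: eq_bigr => i _.
  by rewrite -big_split/=; apply: eq_bigr => j _; rewrite mulrBl subrKC.
apply: (le_trans (ler_normD _ _)).
have main := community_block_sum_le U V theta dUV qUV.
have qm0 : 0 <= qm by apply: le_trans theta_qm.
have deg (M : {set 'I_N}) : #|M|%:R <= m ->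
    \sum_(i in M) \sum_j ((g i j)%:R + qm) <=
    total_resid q z g + (m * N%:R * qm) *+ 2.
  move=> Mm; apply: (le_trans (sum_degree_le M)); rewrite lerD2l lerMn2r /=.
  by rewrite ler_wpM2r// ler_wpM2r.
suff rest : `|\sum_i \sum_j ((((i \in DU) && (j \in DV))%:R -
                    ((z i \in U) && (z j \in V))%:R) * w i j)| <=
    \sum_(i in MU) \sum_j ((g i j)%:R + qm) +
    \sum_(i in MV) \sum_j ((g i j)%:R + qm).
  by have := deg _ mU; have := deg _ mV; lra.
have -> : \sum_(i in MV) \sum_j ((g i j)%:R + qm) =
    \sum_i \sum_(j in MV) ((g i j)%:R + qm).
  rewrite exchange_big/=; apply: eq_bigr => i _; apply: eq_bigr => j _.
  by rewrite simple_graphC.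
rewrite [X in X + _]big_mkcond -big_split/=.
apply: (le_trans (ler_norm_sum _ _ _)); apply: ler_sum => i _.
have -> : (if i \in MU then \sum_j ((g i j)%:R + qm) else 0) =
    \sum_j (i \in MU)%:R * ((g i j)%:R + qm).
  by rewrite -mulr_sumr; case: ifP; rewrite ?mul1r ?mul0r.
rewrite [X in _ + X]big_mkcond -big_split/=.
apply: (le_trans (ler_norm_sum _ _ _)); apply: ler_sum => j _.
rewrite normrM.
have -> : (if j \in MV then (g i j)%:R + qm else 0) = (j \in MV)%:R * ((g i j)%:R + qm).
  by case: ifP; rewrite ?mul1r ?mul0r.
rewrite -mulrDl; apply: ler_pM => //.
(* A pair whose two indicators differ has [i] in [MU] or [j] in [MV]; all membership cases are
   checked. *)
rewrite /MU /MV /symdiff !inE.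
by case: (i \in DU); case: (j \in DV); case: (z i \in U); case: (z j \in V);
   rewrite /= ?subrr ?subr0 ?sub0r ?normrN ?normr0 ?normr1; lra.
Qed.

End BlockSums.

(** * Second moments under the block model *)

Definition toggle_edge {N : nat} (i j : 'I_N) (g : 'M[bool]_N) : 'M[bool]_N :=
  \matrix_(k, l) (g k l (+) (((k == i) && (l == j)) || ((k == j) && (l == i)))).

Lemma toggle_edgeK {N : nat} (i j : 'I_N) : involutive (toggle_edge i j).
Proof. by move=> g; apply/matrixP => k l; rewrite !mxE addbK. Qed.

Lemma toggle_edgeC {N : nat} (i j : 'I_N) g : toggle_edge i j g = toggle_edge j i g.
Proof. by apply/matrixP => k l; rewrite !mxE orbC. Qed.

Lemma simple_toggle_edge {N : nat} (i j : 'I_N) (g : 'M[bool]_N) : i != j ->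
  simple_graph (toggle_edge i j g) = simple_graph g.
Proof.
move=> ij.
have imp (h : 'M[bool]_N) : simple_graph h -> simple_graph (toggle_edge i j h).
  move=> hs; apply/andP; split.
    apply/eqP/matrixP => k l; rewrite !mxE (simple_graphC h hs).
    by congr (_ (+) _); rewrite orbC ![(l == _) && _]andbC.
  apply/forallP => k; rewrite !mxE (simple_graph_loop h hs) addFb.
  by have [->|] := eqVneq k i; rewrite ?(negPf ij)//= andbF.
apply/idP/idP; last exact: imp.
by move=> /imp; rewrite toggle_edgeK.
Qed.

Section Moments.
Context {R : realType} {K : nat} (T : btree 'I_K).
Context (pi : 'I_K -> R) (p : btree 'I_K -> R) {N : nat}.
Implicit Types (z : {ffun 'I_N -> 'I_K}) (g : 'M[bool]_N).

Let q a b := p (lca T a b).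
Let pmf := @hsbm_pmf R K T pi p N.

Let edge z g (x : 'I_N * 'I_N) : R :=
  if g x.1 x.2 then q (z x.1) (z x.2) else 1 - q (z x.1) (z x.2).

Lemma hsbm_pmfE z g : pmf z g =
  if simple_graph g then
    (\prod_(i < N) pi (z i)) * \prod_(x : 'I_N * 'I_N | (x.1 < x.2)%N) edge z g x
  else 0.
Proof. by rewrite /pmf /hsbm_pmf /simple_graph pair_big_dep. Qed.

(* Toggling the edge ij negates every term of the sum, so no product structure
   of the law of the graph is needed to see that edges are uncorrelated. *)
Lemma edge_centered_lt z (i j : 'I_N) (h : 'M[bool]_N -> R) : (i < j)%N ->
  (forall g, h (toggle_edge i j g) = h g) ->
  \sum_g pmf z g * ((g i j)%:R - q (z i) (z j)) * h g = 0.
Proof.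
move=> ij hh; set S := \sum_g _.
have nij : i != j by rewrite -val_eqE /= ltn_eqF.
suff : S = - S by lra.
rewrite {1}/S (reindex_inj (inv_inj (toggle_edgeK i j))) -sumrN.
apply: eq_bigr => g _; rewrite hh -mulNr; congr (_ * _).
rewrite !hsbm_pmfE simple_toggle_edge//; case: ifP => _; last by rewrite !mul0r oppr0.
have D (g' : 'M[bool]_N) : \prod_(x : 'I_N * 'I_N | (x.1 < x.2)%N) edge z g' x =
   edge z g' (i, j) * \prod_(x : 'I_N * 'I_N | (x.1 < x.2)%N && (x != (i, j))) edge z g' x.
  by rewrite (bigD1 (i, j)).
(* The mirrored entry [(j, i)] is not indexed by an increasing pair, so only the factor at [(i, j)]
   sees the toggle. *)
rewrite !D (eq_bigr (edge z g)); last first.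
  move=> [k l] /= /andP[kl]; rewrite xpair_eqE => nkl.
  rewrite /edge /= !mxE (negPf nkl) /=.
  case: eqP => [kj|]; last by rewrite /= addbF.
  case: eqP => [li|]; last by rewrite /= addbF.
  by move: kl; rewrite kj li ltnNge ltnW.
(* The toggle exchanges [q * (1 - q)] with its opposite [(1 - q) * (- q)]. *)
rewrite /edge /= !mxE !eqxx /= addbT.
by case: (g i j) => /=; ring.
Qed.

Lemma edge_centered z (i j : 'I_N) (h : 'M[bool]_N -> R) : i != j ->
  (forall g, h (toggle_edge i j g) = h g) ->
  \sum_g pmf z g * ((g i j)%:R - q (z i) (z j)) * h g = 0.
Proof.
move=> ij hh; have [lij|lji] := ltnP i j; first exact: edge_centered_lt.
have {}lji : (j < i)%N by rewrite ltn_neqAle lji andbT eq_sym val_eqE.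
rewrite -[RHS](edge_centered_lt z j i h lji) => [|g]; last by rewrite toggle_edgeC.
apply: eq_bigr => g _; rewrite hsbm_pmfE; case: ifP => [gs|_]; last by rewrite !mul0r.
by rewrite (simple_graphC g gs) /q lcaC.
Qed.

Hypothesis pi_ge0 : forall k, 0 <= pi k.
Hypothesis pi_sum : \sum_(k < K) pi k = 1.
Hypothesis p01 : forall t, t \in nodes T -> 0 <= p t <= 1.

Let q01 a b : 0 <= q a b <= 1.
Proof. exact/p01/lca_nodes. Qed.

Lemma hsbm_pmf_ge0 z g : 0 <= pmf z g.
Proof.
rewrite hsbm_pmfE; case: ifP => // _; apply: mulr_ge0; first exact: prodr_ge0.
apply: prodr_ge0 => x _; rewrite /edge.
by have /andP[? ?] := q01 (z x.1) (z x.2); case: ifP; lra.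
Qed.

(** In the expanded square, toggling the edge [ij] leaves the entry [ik] unchanged for [k != j], so
    the cross terms vanish; a diagonal term is a Bernoulli variance, at most its mean. The sum over
    [g] at fixed [z] is not normalized, whence the factor [\sum_g pmf z g]. *)
Lemma resid_variance z (i : 'I_N) b :
  \sum_g pmf z g * resid q z g i b ^+ 2 <=
  (\sum_(j | (j != i) && (z j == b)) q (z i) (z j)) * \sum_g pmf z g.
Proof.
pose y g j : R := (g i j)%:R - q (z i) (z j).
have -> : \sum_g pmf z g * resid q z g i b ^+ 2 =
    \sum_(j | (j != i) && (z j == b)) \sum_(k | (k != i) && (z k == b))
      \sum_g pmf z g * y g j * y g k.
  under [RHS]eq_bigr do rewrite exchange_big /=.
  rewrite [RHS]exchange_big /=; apply: eq_bigr => g _.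
  rewrite expr2 mulrA /resid [pmf z g * _]mulr_sumr mulr_suml.
  by apply: eq_bigr => j _; rewrite mulr_sumr.
rewrite mulr_suml; apply: ler_sum => j jb.
have /andP[ji _] := jb.
rewrite (bigD1 j)//= [X in _ + X]big1 ?addr0; last first.
  move=> k /andP[/andP[ki _] kj]; apply: edge_centered => [|g]; first by rewrite eq_sym.
  by rewrite /y !mxE (negPf kj) (negPf ki) andbF /= andbF addbF.
have /andP[q0 q1] := q01 (z i) (z j).
(* For a Bernoulli variable A of mean q, (A - q)^2 = (A - q)(1 - 2q) + q(1 - q). *)
have -> : \sum_g pmf z g * y g j * y g j =
    \sum_g pmf z g * y g j * (1 - q (z i) (z j) *+ 2) +
    q (z i) (z j) * (1 - q (z i) (z j)) * \sum_g pmf z g.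
  rewrite mulr_sumr -big_split /=; apply: eq_bigr => g _.
  by rewrite /y; case: (g i j) => /=; ring.
rewrite edge_centered 1?eq_sym// add0r ler_wpM2r//.
  by apply: sumr_ge0 => g _; apply: hsbm_pmf_ge0.
by rewrite ler_piMr//; lra.
Qed.

Lemma total_resid_variance qm z : (forall a b, q a b <= qm) ->
  \sum_g pmf z g * \sum_i \sum_b resid q z g i b ^+ 2 <=
  N%:R ^+ 2 * qm * \sum_g pmf z g.
Proof.
move=> qqm; have m0 : 0 <= \sum_g pmf z g by apply: sumr_ge0 => g _; apply: hsbm_pmf_ge0.
under eq_bigr do rewrite mulr_sumr.
rewrite exchange_big /= expr2 -!mulrA mulr_natl -[X in _ *+ X]card_ord -sumr_const.
apply: ler_sum => i _; under eq_bigr do rewrite mulr_sumr.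
rewrite exchange_big /=.
apply: (@le_trans _ _ (\sum_b
    (\sum_(j | (j != i) && (z j == b)) q (z i) (z j)) * \sum_g pmf z g)).
  by apply: ler_sum => b _; apply: resid_variance.
rewrite -mulr_suml mulrA ler_wpM2r//.
(* Over all [b] the inner sums cover each [j != i] once; adding back [j = i] gives [N] terms of size
   at most [qm]. *)
rewrite -(partition_big z predT)//= mulr_natl -[X in _ *+ X]card_ord -sumr_const.
rewrite [leRHS](bigD1 i)//= -[leLHS]add0r lerD//.
  by have /andP[q0 _] := q01 (z i) (z i); apply: le_trans q0 (qqm _ _).
by apply: ler_sum.
Qed.

(** A simple graph is a free choice of one bit per pair [i < j], so the sum of products is a product
    of factors [q + (1 - q)]. *)
Lemma sum_hsbm_pmf z : \sum_g pmf z g = \prod_(i < N) pi (z i).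
Proof.
under eq_bigr do rewrite hsbm_pmfE.
rewrite -big_mkcond -mulr_sumr -[RHS]mulr1; congr (_ * _).
pose toM (f : {ffun 'I_N * 'I_N -> bool}) : 'M[bool]_N :=
  \matrix_(i, j) (f (i, j) || f (j, i)).
pose ofM g : {ffun 'I_N * 'I_N -> bool} := [ffun x : 'I_N * 'I_N => (x.1 < x.2)%N && g x.1 x.2].
pose F (x : 'I_N * 'I_N) (b : bool) : R :=
  if b then q (z x.1) (z x.2) else 1 - q (z x.1) (z x.2).
transitivity (\prod_(x : 'I_N * 'I_N | (x.1 < x.2)%N) \sum_b F x b); last first.
  by rewrite big1 // => x _; rewrite big_bool /F /= addrC subrK.
(* Distributivity yields functions equal to [false] off the increasing pairs; [toM] symmetrizes such
   a function and [ofM] reads it back from the upper triangle. *)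
rewrite (big_distr_big false).
rewrite (reindex_onto toM ofM) => [|g gs]; last first.
  apply/matrixP => i j; rewrite !mxE !ffunE /= (simple_graphC g gs j i).
  case: ltngtP => /= [_|_|/val_inj ->]; rewrite ?orbF//.
  by rewrite (simple_graph_loop g gs).
apply: eq_big => [f|f /andP[_ /eqP fK]]; last first.
  apply: eq_bigr => -[i j] /= ij; rewrite /edge /F -[in RHS]fK /=.
  by rewrite ffunE /= ij.
apply/andP/pffun_onP => [[_ /eqP <-]|[fs _]].
  split; last by move=> ?.
  apply/fintype.subsetP => x; rewrite inE ffunE unfold_in.
  by case: (x.1 < x.2)%N.
have f0 (i j : 'I_N) : ~~ (i < j)%N -> f (i, j) = false.
  move=> ij; apply/negP => fij; move/fintype.subsetP/(_ (i, j)): fs.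
  by rewrite !inE /= fij unfold_in /= (negPf ij) => /(_ isT).
split.
  apply/andP; split; first by apply/eqP/matrixP => i j; rewrite !mxE orbC.
  by apply/forallP => i; rewrite !mxE f0 ?ltnn.
apply/eqP/ffunP => -[i j]; rewrite ffunE mxE /=.
have [ij|ij] := ltnP i j; last by rewrite f0// -leqNgt.
by rewrite (f0 j i) ?orbF// -leqNgt ltnW.
Qed.

Lemma sum_prod_pi (F : 'I_N -> 'I_K -> R) :
  \sum_(z : {ffun 'I_N -> 'I_K}) (\prod_(i < N) pi (z i)) * \prod_(i < N) F i (z i) =
  \prod_(i < N) \sum_(k < K) pi k * F i k.
Proof.
rewrite bigA_distr_bigA; apply: eq_bigr => z _.
by rewrite -big_split.
Qed.

Lemma sum_pi1 : \sum_(z : {ffun 'I_N -> 'I_K}) \prod_(i < N) pi (z i) = 1.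
Proof.
transitivity (\prod_(i < N) \sum_k pi k); last by rewrite big1.
by rewrite bigA_distr_bigA.
Qed.

(** The size is a sum of independent indicators of mean [pi a]. After centering, the cross terms
    vanish and each of the [N] squares is at most 1. *)
Lemma community_size_variance a :
  \sum_(z : {ffun 'I_N -> 'I_K}) (\prod_(i < N) pi (z i)) * (#|communities z a|%:R - N%:R * pi a) ^+ 2
  <= N%:R.
Proof.
pose x (k : 'I_K) : R := (k == a)%:R - pi a.
have pi1 : pi a <= 1.
  by rewrite -pi_sum (bigD1 a)//= lerDl sumr_ge0.
have x_mean : \sum_k pi k * x k = 0.
  under eq_bigr do rewrite mulrBr.
  rewrite sumrB -mulr_suml pi_sum mul1r (bigD1 a)//= eqxx mulr1 big1 ?addr0 ?subrr//.
  by move=> k /negPf ->; rewrite mulr0.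
have sizeE z : #|communities z a|%:R - N%:R * pi a = \sum_i x (z i).
  rewrite /x sumrB sumr_const card_ord mulr_natl; congr (_ - _).
  rewrite ffunE -sum1_card natr_sum [LHS]big_mkcond /=.
  by apply: eq_bigr => i _; rewrite inE; case: eqP.
have -> : \sum_(z : {ffun 'I_N -> 'I_K}) (\prod_(i < N) pi (z i)) * (#|communities z a|%:R - N%:R * pi a) ^+ 2
   = \sum_i \sum_j \sum_(z : {ffun 'I_N -> 'I_K}) (\prod_(i < N) pi (z i)) * (x (z i) * x (z j)).
  under [RHS]eq_bigr do rewrite exchange_big /=.
  rewrite [RHS]exchange_big /=; apply: eq_bigr => z _.
  rewrite sizeE expr2 mulr_suml mulr_sumr; apply: eq_bigr => i _.
  by rewrite !mulr_sumr.
rewrite -[leRHS]mulr1 mulr_natl -[X in _ *+ X]card_ord -sumr_const.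
apply: ler_sum => i _; rewrite (bigD1 i)//= [X in _ + X]big1 ?addr0.
  apply: (@le_trans _ _ (\sum_(z : {ffun 'I_N -> 'I_K}) \prod_(k < N) pi (z k)));
    last by rewrite sum_pi1.
  apply: ler_sum => z _; rewrite ler_piMr ?prodr_ge0//.
  rewrite /x; have := pi_ge0 a; case: eqP => _ /=; nra.
(* [F] puts [x] at the positions [i] and [j] and 1 elsewhere, so the expectation factorizes over
   positions; its factor at [i] is the mean of [x], which is zero. *)
move=> j ji; pose F (k : 'I_N) c : R := (if k == i then x c else 1) * (if k == j then x c else 1).
have -> : \sum_(z : {ffun 'I_N -> 'I_K}) (\prod_(i < N) pi (z i)) * (x (z i) * x (z j)) =
    \sum_(z : {ffun 'I_N -> 'I_K}) (\prod_(i < N) pi (z i)) * \prod_(k < N) F k (z k).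
  apply: eq_bigr => z _; congr (_ * _).
  by rewrite big_split/= -!big_mkcond /= !big_pred1_eq.
rewrite sum_prod_pi (bigD1 i)//=.
rewrite (eq_bigr (fun k => pi k * x k)) ?x_mean ?mul0r// => k _.
by rewrite /F eqxx eq_sym (negPf ji) mulr1.
Qed.

End Moments.

(** * Recovery from small errors *)

Lemma mem_node_set {K N : nat} (Ch : {ffun 'I_K -> {set 'I_N}}) (t : btree 'I_K) i :
  reflect (exists2 k, k \in leaves t & i \in Ch k) (i \in node_set Ch t).
Proof.
rewrite /node_set; elim: (leaves t) => [|k s IH].
  by rewrite big_nil inE; constructor => -[].
rewrite big_cons inE; apply: (iffP orP).
  case=> [ik|/IH[l ls il]]; first by exists k; rewrite ?mem_head.
  by exists l; rewrite // inE ls orbT.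
case=> l; rewrite inE => /orP[/eqP ->|ls il]; first by left.
by right; apply/IH; exists l.
Qed.

(** Each node of the symmetric difference is misclassified at some index: at its own label [z i] if
    the cluster misses it, and at [tau^-1 k] if it was wrongly put in [Ch k] for a leaf [k] of
    [x]. *)
Lemma symdiff_node_set_le {K N : nat} (z : {ffun 'I_N -> 'I_K})
    (Ch : {ffun 'I_K -> {set 'I_N}}) (tau : 'S_K) (x n : btree 'I_K) :
  same_tree (map_btree (tau^-1)%g x) n ->
  (#|symdiff [set i | z i \in leaves n]%SET (node_set Ch x)| <=
   mismatch (communities z) Ch tau)%N.
Proof.
move=> /same_tree_leaves xn; have {}xn k : (k \in leaves n) = (tau k \in leaves x).
  rewrite -(perm_mem xn) leaves_map -[in LHS](permK tau k) mem_map//.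
  exact: perm_inj.
rewrite /mismatch; apply: (@leq_trans
   (\sum_(k < K) \sum_(i < N) (i \in symdiff (communities z k) (Ch (tau k))))%N).
  rewrite -sum1_card big_mkcond exchange_big /=; apply: leq_sum => i _.
  case: ifP => //; rewrite !inE => /orP[/andP[iD zin]|/andP[zin iD]].
    rewrite (bigD1 (z i))//= !inE ffunE inE eqxx /=.
    suff -> : i \notin Ch (tau (z i)) by [].
    by apply: contraNN iD => iC; apply/mem_node_set; exists (tau (z i)) => //; rewrite -xn.
  have /mem_node_set[k kx ik] := iD.
  rewrite (bigD1 ((tau^-1)%g k))//= !inE ffunE inE permKV ik /= andbT.
  suff -> : z i != (tau^-1)%g k by [].
  by apply: contraNneq zin => ->; rewrite xn permKV.
apply: leq_sum => k _; rewrite -sum1_card [leqRHS]big_mkcond /=.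
by apply: leq_sum => i _; case: ifP.
Qed.

(** Estimated clusters keep at least [c] nodes, so dividing the bound of [block_sum_le] by the
    product of two cluster sizes, at least [c ^+ 2], brings every density within [e] of its target.
    No probability enters here. *)
Lemma recovers_of_small_errors {R : realType} {K N : nat} (T : btree 'I_K)
    (p : btree 'I_K -> R) (z : {ffun 'I_N -> 'I_K}) (g : 'M[bool]_N)
    (Ch : {ffun 'I_K -> {set 'I_N}}) (e qm c m : R) :
  leaf_labelled T -> assortative T p ->
  (forall t, t \in nodes T -> 0 <= p t <= qm) ->
  (forall l r, BNode l r \in nodes T ->
    p (BNode l r) + e *+ 2 <= p l /\ p (BNode l r) + e *+ 2 <= p r) ->
  simple_graph g -> 0 < c -> (forall k, c *+ 2 <= #|communities z k|%:R) ->
  (loss (communities z) Ch)%:R <= m -> m <= c ->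
  total_resid (fun a b => p (lca T a b)) z g *+ 3 + (m * N%:R * qm) *+ 4
    < e * c ^+ 2 ->
  recovers R g Ch T (communities z).
Proof.
move=> lT pT p_bound gap gs c0 sizes lossm mc err tau t tau_min.
apply: (average_linkage_correct lT p e _ _ pT gap); first exact: perm_inj.
move=> x y n n' a b nT n'T xn yn' dis an bn'.
have uT : uniq (leaves T) by rewrite (perm_uniq lT) enum_uniq.
have sd u v : same_tree (map_btree (tau^-1)%g u) v ->
    #|symdiff [set i | z i \in leaves v]%SET (node_set Ch u)|%:R <= m.
  move=> uv; apply: le_trans lossm; rewrite ler_nat -tau_min.
  exact: symdiff_node_set_le.
have big u v d : same_tree (map_btree (tau^-1)%g u) v -> d \in leaves v ->
    c <= #|node_set Ch u|%:R.
  move=> uv dv; have := sd _ _ uv; have := sizes d.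
  have : (#|communities z d| <= #|node_set Ch u| +
     #|symdiff [set i | z i \in leaves v]%SET (node_set Ch u)|)%N.
    apply: leq_trans (leq_card_setU _ _); apply: subset_leq_card.
    apply/fintype.subsetP => i; rewrite ffunE !inE => /eqP ->.
    by rewrite dv andbT; case: (i \in node_set Ch u).
  by rewrite -(ler_nat R) natrD; lra.
have cX := big _ _ _ xn an; have cY := big _ _ _ yn' bn'.
set X := node_set Ch x in cX *; set Y := node_set Ch y in cY *.
set theta := p (lca T a b).
have X0 : 0 < #|X|%:R :> R by apply: lt_le_trans cX.
have Y0 : 0 < #|Y|%:R :> R by apply: lt_le_trans cY.
have -> : density R g X Y - theta = (#|X|%:R * #|Y|%:R)^-1 *
    \sum_(i in X) \sum_(j in Y) ((g i j)%:R - theta).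
  have -> : \sum_(i in X) \sum_(j in Y) ((g i j)%:R - theta) =
      \sum_(i in X) \sum_(j in Y) (g i j)%:R - #|X|%:R * #|Y|%:R * theta.
    under eq_bigr do rewrite sumrB.
    rewrite sumrB !sumr_const; congr (_ - _).
    by rewrite -[in LHS]mulr_natl -[theta *+ _]mulr_natl mulrA.
  by rewrite mulrBr mulKf// mulf_neq0// gt_eqF.
(* Positivity of [e] is implicit in the strict bound [err], whose left side is nonnegative. *)
have e0 : 0 < e.
  rewrite -(pmulr_lgt0 _ (exprn_gt0 2 c0)); apply: le_lt_trans err.
  have m0 : 0 <= m by apply: le_trans lossm.
  have /andP[h1 h2] := p_bound T (nodes_refl T).
  rewrite addr_ge0 ?mulrn_wge0 ?mulr_ge0//; last exact: le_trans h2.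
  by apply: sumr_ge0 => i _; apply: sumr_ge0.
rewrite normrM ger0_norm; last by rewrite invr_ge0 mulr_ge0// ltW.
rewrite mulrC ltr_pdivrMr ?mulr_gt0//.
apply: (@lt_le_trans _ _ (e * c ^+ 2)); last first.
  by rewrite ler_wpM2l ?(ltW e0)// expr2 ler_pM// ltW.
apply: le_lt_trans err.
pose U := [set k | k \in leaves n]%SET; pose V := [set k | k \in leaves n']%SET.
have UE v : [set i | z i \in [set k | k \in leaves v]%SET]%SET =
    [set i | z i \in leaves v]%SET :> {set 'I_N} by apply/setP => i; rewrite !inE.
apply: (block_sum_le _ _ z g gs _ U V).
- by move=> k l; apply/p_bound/lca_nodes.
- by move=> k; rewrite !inE; apply: dis.
- exact/p_bound/lca_nodes.
- move=> k l; rewrite !inE => kn ln'.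
  by congr p; apply: (lca_disjoint_nodes T n n').
- by rewrite /U UE; apply: sd.
- by rewrite /V UE; apply: sd.
Qed.

(** Cauchy-Schwarz over the [N * K] residuals, without square roots; [lam] bounds their root mean
    square. *)
Lemma total_resid_le {R : realType} {K N : nat} (q : 'I_K -> 'I_K -> R)
    (z : {ffun 'I_N -> 'I_K}) (g : 'M[bool]_N) (lam : R) : 0 < lam ->
  \sum_i \sum_b resid q z g i b ^+ 2 <= N%:R * K%:R * lam ^+ 2 ->
  total_resid q z g <= N%:R * K%:R * lam.
Proof.
move=> lam0 h.
have : lam * total_resid q z g *+ 2 <=
    \sum_i \sum_b resid q z g i b ^+ 2 + N%:R * K%:R * lam ^+ 2.
  have -> : N%:R * K%:R * lam ^+ 2 = \sum_(i < N) \sum_(b < K) lam ^+ 2.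
    by rewrite !sumr_const !card_ord -mulrA !mulr_natl.
  rewrite -big_split /= /total_resid mulr_sumr -sumrMnl.
  apply: ler_sum => i _; rewrite -big_split mulr_sumr -sumrMnl /=.
  apply: ler_sum => b _; rewrite -[resid _ _ _ _ _ ^+ 2]real_normK ?num_real//.
  (* AM-GM: [2 lam |r| <= r^2 + lam^2] *)
  have := sqr_ge0 (`|resid q z g i b| - lam); nra.
move=> h2; rewrite -(ler_pM2l lam0).
have : lam * (N%:R * K%:R * lam) = N%:R * K%:R * lam ^+ 2 by ring.
lra.
Qed.

(** * Convergence in probability *)

Lemma finite_rv_measurable {d : measure_display} {Om : measurableType d} {F : finType}
    (X : Om -> F) (Q : F -> Prop) : finite_rv X -> measurable [set w | Q (X w)].
Proof.
move=> mX; have -> : [set w | Q (X w)] = \bigcup_(x in [set x | Q x]) [set w | X w = x].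
  by apply/seteqP; split=> [w Qw|w [x Qx /= ->]//]; exists (X w).
by apply: fin_bigcup_measurable => // x _; apply: mX.
Qed.

Lemma finite_rv_pair {d : measure_display} {Om : measurableType d} {F G : finType}
    (X : Om -> F) (Y : Om -> G) :
  finite_rv X -> finite_rv Y -> finite_rv (fun w => (X w, Y w)).
Proof.
move=> mX mY [x y].
have -> : [set w | (X w, Y w) = (x, y)] = [set w | X w = x] `&` [set w | Y w = y].
  by apply/seteqP; split=> w /= [-> ->].
exact: measurableI.
Qed.

Lemma finite_rv_prob {d : measure_display} {Om : measurableType d} {R : realType}
    (P : probability Om R) {F : finType} (X : Om -> F) (w : F -> R) (Q : pred F) :
  finite_rv X -> (forall x, P [set u | X u = x] = (w x)%:E) ->
  P [set u | Q (X u)] = (\sum_(x | Q x) w x)%:E.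
Proof.
move=> mX PX.
have -> : [set u | Q (X u)] = \bigcup_(x in [set` enum Q]) [set u | X u = x].
  apply/seteqP; split=> [u Qu|u [x /=]]; last by rewrite mem_enum => Qx ->.
  by exists (X u); rewrite //= mem_enum.
rewrite measure_fin_bigcup//.
- rewrite -fsbig_seq ?enum_uniq//= big_enum /= -sumEFin.
  by apply: eq_bigr => x _; apply: PX.
- by move=> x y _ _ [u] [] /= <-.
Qed.

(** The bounds are put on squares, whose expectations are under control, and the event is boolean so
    that its probability is a finite sum of masses. *)
Definition typical {R : realType} {K N : nat} (q : 'I_K -> 'I_K -> R) (pi : 'I_K -> R)
    (c s : R) (z : {ffun 'I_N -> 'I_K}) (g : 'M[bool]_N) : bool :=
  [&& simple_graph g, \sum_i \sum_b resid q z g i b ^+ 2 <= c &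
      [forall k, (#|communities z k|%:R - N%:R * pi k) ^+ 2 <= s]].

(** Markov's inequality and the union bound in one sum: on an atypical simple graph one of the
    nonnegative ratios [Q / c] and [dev k / s] exceeds 1, and the other matrices have mass zero. *)
Lemma hsbm_atypical_prob_le {R : realType} {d : measure_display} {Om : measurableType d}
    (P : probability Om R) {K N : nat} (T : btree 'I_K) (pi : 'I_K -> R)
    (p : btree 'I_K -> R) (Z : Om -> {ffun 'I_N -> 'I_K}) (A : Om -> 'M[bool]_N)
    (qm c s : R) :
  is_hsbm P T pi p Z A -> (forall k, 0 <= pi k) -> \sum_(k < K) pi k = 1 ->
  (forall t, t \in nodes T -> 0 <= p t <= 1) ->
  (forall t, t \in nodes T -> p t <= qm) -> 0 < c -> 0 < s ->
  (P [set u | ~~ typical (fun a b => p (lca T a b)) pi c s (Z u) (A u)] <=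
   (N%:R ^+ 2 * qm / c + K%:R * N%:R / s)%:E)%E.
Proof.
move=> [mZ mA pmfE] pi_ge0 pi_sum p01 p_qm c0 s0.
set q := fun a b => p (lca T a b).
pose pmf := @hsbm_pmf R K T pi p N.
pose Q z g := \sum_(i < N) \sum_b resid q z g i b ^+ 2.
pose dev (z : {ffun 'I_N -> 'I_K}) k : R := (#|communities z k|%:R - N%:R * pi k) ^+ 2.
have pmf0 z g : 0 <= pmf z g by apply: hsbm_pmf_ge0.
have Q0 z g : 0 <= Q z g by apply: sumr_ge0 => i _; apply: sumr_ge0 => b _; apply: sqr_ge0.
have dev0 z k : 0 <= dev z k by apply: sqr_ge0.
have mass : \sum_z \sum_g pmf z g = 1.
  by under eq_bigr do rewrite sum_hsbm_pmf; apply: sum_pi1.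
rewrite (finite_rv_prob P (fun u => (Z u, A u)) (fun x => pmf x.1 x.2)
  (fun x => ~~ typical q pi c s x.1 x.2)); last 2 first.
- exact: finite_rv_pair.
- move=> [z g]; rewrite -pmfE; congr (P _).
  by apply/seteqP; split=> u /= [-> ->].
rewrite lee_fin; apply: (@le_trans _ _
  (\sum_z \sum_g pmf z g * (Q z g / c + \sum_k dev z k / s))).
  rewrite pair_bigA big_mkcond /=; apply: ler_sum => -[z g] _ /=.
  have D0 k : 0 <= dev z k / s by rewrite divr_ge0// ltW.
  have F0 : 0 <= Q z g / c + \sum_k dev z k / s.
    by rewrite addr_ge0 ?sumr_ge0// divr_ge0// ltW.
  case: ifP => [ntyp|_]; last exact: mulr_ge0.
  have [gs|ngs] := boolP (simple_graph g); last first.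
    by rewrite /pmf hsbm_pmfE (negPf ngs) mul0r.
  rewrite ler_peMr//; move: ntyp; rewrite /typical gs /= negb_and -ltNge.
  case/orP => [cQ|/forallPn /= [k]].
    rewrite -[leLHS]addr0 lerD ?sumr_ge0//.
    by rewrite ler_pdivlMr// mul1r ltW.
  rewrite -ltNge => sk; rewrite -[leLHS]add0r lerD ?divr_ge0 ?(ltW c0)//.
  by rewrite (bigD1 k)//= -[leLHS]addr0 lerD ?sumr_ge0// ler_pdivlMr// mul1r ltW.
under eq_bigr do [under eq_bigr do rewrite mulrDr; rewrite big_split /=].
rewrite big_split /= lerD//.
  have -> : \sum_z \sum_g pmf z g * (Q z g / c) = (\sum_z \sum_g pmf z g * Q z g) / c.
    rewrite mulr_suml; apply: eq_bigr => z _; rewrite mulr_suml.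
    by apply: eq_bigr => g _; rewrite mulrA.
  rewrite ler_pdivrMr// divfK ?gt_eqF// -[leRHS]mulr1 -[X in _ * X]mass mulr_sumr.
  apply: ler_sum => z _;
  apply: total_resid_variance => // a b.
  exact/p_qm/lca_nodes.
have -> : \sum_z \sum_g pmf z g * (\sum_k dev z k / s) =
    \sum_k (\sum_(z : {ffun 'I_N -> 'I_K}) (\prod_(i < N) pi (z i)) * dev z k) / s.
  under eq_bigr do rewrite -mulr_suml sum_hsbm_pmf mulr_sumr.
  rewrite exchange_big /=; apply: eq_bigr => k _; rewrite mulr_suml.
  by apply: eq_bigr => z _; rewrite mulrA.
rewrite -mulrA mulr_natl -[X in _ *+ X]card_ord -sumr_const; apply: ler_sum => k _.
by rewrite ler_pM2r ?invr_gt0//; apply: community_size_variance.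
Qed.

(** * Uniform constants and passage to the limit *)

Lemma seq_lower_bound {R : realType} {I : eqType} (s : seq I) (f : I -> R) :
  (forall x, x \in s -> 0 < f x) ->
  exists2 c, 0 < c & forall x, x \in s -> c <= f x.
Proof.
elim: s => [|y s IH] fs; first by exists 1.
have [x xs|c c0 cs] := IH; first by apply: fs; rewrite inE xs orbT.
exists (Num.min c (f y)); first by rewrite lt_min c0 fs ?mem_head.
move=> x; rewrite inE ge_min => /orP[/eqP ->|/cs ->//]; by rewrite lexx orbT.
Qed.

Lemma seq_upper_bound {R : realType} {I : eqType} (s : seq I) (f : I -> R) :
  exists2 c, 0 < c & forall x, x \in s -> f x <= c.
Proof.
elim: s => [|y s [c c0 cs]]; first by exists 1.
exists (Num.max c (f y)); first by rewrite lt_max c0.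
move=> x; rewrite inE le_max => /orP[/eqP ->|/cs ->//]; by rewrite lexx orbT.
Qed.

Lemma cvg_inv_infty {R : realType} (c : R) (f : nat -> R) :
  f N @[N --> \oo] --> +oo -> c / f N @[N --> \oo] --> 0.
Proof.
move=> foo; rewrite -[X in _ --> X](mulr0 c); apply: cvgMr.
by apply/gtr0_cvgV0 => //; apply: cvgry_gt foo 0.
Qed.

(** Errors are measured in units of [N ^+ 2 * delta]: residuals cost [3 * eta], misclassified nodes
    [4 * eps * am], and the budget is [(gamma / 2) * (c0 / 4) ^+ 2 = gamma * c0 ^+ 2 / 32]. *)
Lemma typical_recovers {R : realType} {K N : nat} (T : btree 'I_K)
    (pi : 'I_K -> R) (p : btree 'I_K -> R) (delta gamma am c0 eps eta : R)
    (z : {ffun 'I_N -> 'I_K}) (g : 'M[bool]_N) (Ch : {ffun 'I_K -> {set 'I_N}}) :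
  leaf_labelled T -> assortative T p ->
  (forall t, t \in nodes T -> 0 <= p t <= am * delta) ->
  (forall l r, BNode l r \in nodes T ->
    p (BNode l r) + gamma * delta <= p l /\ p (BNode l r) + gamma * delta <= p r) ->
  (0 < N)%N -> (0 < K)%N -> 0 < delta -> 0 < c0 -> 0 < eta ->
  (forall k, c0 <= pi k) -> eps <= c0 / 4 ->
  eta * 3 + eps * am * 4 < gamma * c0 ^+ 2 / 32 ->
  typical (fun a b => p (lca T a b)) pi
    (N%:R * K%:R * (eta * (N%:R * delta) / K%:R) ^+ 2) ((c0 * N%:R / 2) ^+ 2) z g ->
  N%:R^-1 * (loss (communities z) Ch)%:R <= eps ->
  recovers R g Ch T (communities z).
Proof.
move=> lT pT p_bound gap N0 K0 delta0 c00 eta0 pi_c0 eps_c0 small /and3P[gs Qle /forallP sizes].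
have n0 : 0 < N%:R :> R by rewrite ltr0n.
have k0 : 0 < K%:R :> R by rewrite ltr0n.
rewrite mulrC ler_pdivrMr// => lossle.
apply: (recovers_of_small_errors T p z g Ch (gamma * delta / 2) (am * delta)
  (c0 * N%:R / 4) (eps * N%:R) lT pT) => //.
- move=> l r /gap; rewrite [_ / 2 *+ 2](_ : _ = gamma * delta)//.
  by rewrite -mulrnAl -mulr_natr mulfK// pnatr_eq0.
- by rewrite divr_gt0// mulr_gt0.
(* A deviation of at most [c0 * N / 2] from [N * pi k] leaves [c0 * N / 2] nodes, twice the lower
   bound required of the clusters. *)
- move=> k; have := sizes k; have := pi_c0 k.
  move: (pi k) (#|_|%:R : R) (N%:R : R) n0 => x y n n0 cx.
  move=> h; rewrite leNgt; apply/negP => neg.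
  have h1 : c0 * n <= x * n by rewrite ler_wpM2r// ltW.
  have h2 : 0 < c0 * n by rewrite mulr_gt0.
  have h3 : c0 * n / 2 < n * x - y by rewrite mulr2n in neg; lra.
  nra.
- by rewrite mulrAC ler_wpM2r// ltW.
have lam0 : 0 < eta * (N%:R * delta) / K%:R by rewrite divr_gt0// !mulr_gt0.
have := total_resid_le _ z g _ lam0 Qle.
have -> : N%:R * K%:R * (eta * (N%:R * delta) / K%:R) = eta * (N%:R ^+ 2 * delta).
  by field; rewrite gt_eqF.
have w0 : 0 < N%:R ^+ 2 * delta by rewrite mulr_gt0// exprn_gt0.
move=> S_le; have := small; rewrite -(ltr_pM2r w0) => small'.
have -> : gamma * delta / 2 * (c0 * N%:R / 4) ^+ 2 =
    gamma * c0 ^+ 2 / 32 * (N%:R ^+ 2 * delta) by field.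
apply: le_lt_trans small'.
have -> : eps * N%:R * N%:R * (am * delta) *+ 4 = eps * am * 4 * (N%:R ^+ 2 * delta).
  by rewrite -mulr_natr; ring.
by rewrite mulrDl lerD2r; lra.
Qed.

Theorem theorem1 (R : realType) (K : nat)
  (T : btree 'I_K) (T_leaves : leaf_labelled T)
  (pi : 'I_K -> R) (pi_in01 : forall k, 0 < pi k < 1)
  (pi_sum : \sum_(k < K) pi k = 1)
  (p : nat -> btree 'I_K -> R)
  (p_in01 : forall N t, t \in nodes T -> 0 <= p N t <= 1)
  (p_assortative : forall N, assortative T (p N))
  (a : btree 'I_K -> R) (a_gt0 : forall t, t \in nodes T -> 0 < a t)
  (delta : nat -> R)
  (p_scaling : forall N t, t \in nodes T -> p N t = a t * delta N)
  (Ndelta_infty : N%:R * delta N @[N --> \oo] --> +oo)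
  (d : nat -> measure_display) (Om : forall N, measurableType (d N))
  (P : forall N, probability (Om N) R)
  (Z : forall N, Om N -> {ffun 'I_N -> 'I_K})
  (A : forall N, Om N -> 'M[bool]_N)
  (GN_hsbm : forall N, is_hsbm (P N) T pi (p N) (Z N) (A N))
  (Chat : forall N, Om N -> {ffun 'I_K -> {set 'I_N}})
  (Chat_rv : forall N, finite_rv (Chat N))
  (Chat_partition : forall N w, ordered_partition (Chat N w))
  (Chat_almost_exact :
     almost_exact P (fun N w => communities (Z N w)) Chat) :
  P N [set w | recovers R (A N w) (Chat N w) T (communities (Z N w))]
    @[N --> \oo] --> 1%E.
Proof.
have uT : uniq (leaves T) by rewrite (perm_uniq T_leaves) enum_uniq.
have K0 : (0 < K)%N by have [k _] := leaves_exists T; apply: leq_ltn_trans (ltn_ord k).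
have k0 : 0 < K%:R :> R by rewrite ltr0n.
have child l r : BNode l r \in nodes T -> l \in nodes T /\ r \in nodes T.
  move=> wT; split; apply: (nodes_trans _ _ _ wT).
    by rewrite nodesBNode nodes_refl orbT.
  by rewrite nodesBNode nodes_refl !orbT.
have a_assort l r : BNode l r \in nodes T -> a (BNode l r) < a l /\ a (BNode l r) < a r.
  move=> wT; have [lT rT] := child _ _ wT.
  (* One index with [delta N0 > 0] is enough to transfer assortativity from [p] to [a]; divergence
     of [N * delta N] provides it. *)
  have [N0 _ /(_ N0 (leqnn N0)) /= Nd] := cvgry_gt Ndelta_infty 0.
  have d0 : 0 < delta N0.
    have n0 : 0 <= N0%:R :> R by [].
    by rewrite ltNge; apply/negP => d0; nra.
  have [] := p_assortative N0 _ _ wT.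
  by rewrite !p_scaling// !ltr_pM2r.
have [gamma gamma0 a_gap] : exists2 gamma, 0 < gamma &
    forall l r, BNode l r \in nodes T ->
      a (BNode l r) + gamma <= a l /\ a (BNode l r) + gamma <= a r.
  (* Smallest increment of [a] from a node to its children; leaves receive the harmless positive
     value 1. *)
  pose f (t : btree 'I_K) :=
    if t is BNode l r then Num.min (a l - a t) (a r - a t) else 1.
  have [|c c0 cf] := seq_lower_bound (nodes T) f.
    by case=> [//|l r] /a_assort[al ar]; rewrite /f lt_min !subr_gt0 al ar.
  exists c => // l r /cf; rewrite /f le_min => /andP[].
  by rewrite !lerBrDl.
have [am am0 a_am] := seq_upper_bound (nodes T) a.
have [|c0 c00 pi_c0] := seq_lower_bound (enum 'I_K) pi.
  by move=> k _; have /andP[] := pi_in01 k.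
(* [kappa] is the error budget: [eta] and [eps] each spend at most a quarter of it, so the
   inequality stays strict. *)
pose kappa := gamma * c0 ^+ 2 / 32.
have kappa0 : 0 < kappa by rewrite divr_gt0// mulr_gt0// exprn_gt0.
pose eta := kappa / 12.
have eta0 : 0 < eta by rewrite divr_gt0.
pose eps := Num.min (c0 / 4) (kappa / (16 * am)).
have eps0 : 0 < eps by rewrite /eps lt_min !divr_gt0 ?mulr_gt0.
have eps_c0 : eps <= c0 / 4 by rewrite /eps ge_min lexx.
have eps_am : eps * am * 4 <= kappa / 4.
  have : eps <= kappa / (16 * am) by rewrite /eps ge_min lexx orbT.
  rewrite ler_pdivlMr ?mulr_gt0//; lra.
have small : eta * 3 + eps * am * 4 < gamma * c0 ^+ 2 / 32.
  by rewrite -/kappa /eta; lra.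
pose rec N := [set w | recovers R (A N w) (Chat N w) T (communities (Z N w))].
pose far N := [set w | eps < N%:R^-1 * (loss (communities (Z N w)) (Chat N w))%:R].
(* Constants of the two Markov bounds, for the residuals and for the community sizes, once the
   thresholds of [typical] are substituted. *)
pose C1 := K%:R * am / eta ^+ 2; pose C2 := K%:R * 4 / c0 ^+ 2.
have mZ N : finite_rv (Z N) by have [] := GN_hsbm N.
have mA N : finite_rv (A N) by have [] := GN_hsbm N.
have mrec N : measurable (rec N).
  exact: (finite_rv_measurable (fun w => (A N w, Chat N w, Z N w))
    (fun x => recovers R x.1.1 x.1.2 T (communities x.2))
    (finite_rv_pair _ _ (finite_rv_pair _ _ (mA N) (Chat_rv N)) (mZ N))).
have mfar N : measurable (far N).
  exact: (finite_rv_measurable (fun w => (Chat N w, Z N w))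
    (fun x => eps < N%:R^-1 * (loss (communities x.2) x.1)%:R)
    (finite_rv_pair _ _ (Chat_rv N) (mZ N))).
have lower : \forall N \near \oo,
    (1 - (P N (far N) + (C1 / (N%:R * delta N) + C2 / N%:R)%:E) <= P N (rec N) <= 1)%E.
  near=> N.
  have N0 : (0 < N)%N by near: N; apply: nbhs_infty_gt.
  have n0 : 0 < N%:R :> R by rewrite ltr0n.
  have Nd : 0 < N%:R * delta N by near: N; apply: cvgry_gt Ndelta_infty 0.
  have d0 : 0 < delta N by move: Nd; rewrite pmulr_rgt0.
  rewrite probability_le1// andbT.
  pose c := N%:R * K%:R * (eta * (N%:R * delta N) / K%:R) ^+ 2.
  pose s := (c0 * N%:R / 2) ^+ 2.
  pose typ w := typical (fun a b => p N (lca T a b)) pi c s (Z N w) (A N w).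
  have mtyp : measurable [set w | ~~ typ w].
    exact: (finite_rv_measurable (fun w => (Z N w, A N w))
      (fun x => ~~ typical (fun a b => p N (lca T a b)) pi c s x.1 x.2)
      (finite_rv_pair _ _ (mZ N) (mA N))).
  have cE : N%:R ^+ 2 * (am * delta N) / c + K%:R * N%:R / s =
      C1 / (N%:R * delta N) + C2 / N%:R.
    by rewrite /c /s /C1 /C2; field; rewrite !gt_eqF.
  have typ_le : (P N [set w | ~~ typ w] <= (C1 / (N%:R * delta N) + C2 / N%:R)%:E)%E.
    rewrite -cE; apply: hsbm_atypical_prob_le => //.
    - by move=> k; have /andP[/ltW] := pi_in01 k.
    - exact: p_in01.
    - by move=> t tT; rewrite p_scaling// ler_wpM2r ?(ltW d0)// a_am.
    - by rewrite /c mulr_gt0 ?exprn_gt0// ?divr_gt0// !mulr_gt0.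
    - by rewrite /s exprn_gt0// divr_gt0// mulr_gt0.
  (* The estimator enters only through its loss, so its correlation with the edges is absorbed by a
     union bound. *)
  have sub : ~` rec N `<=` far N `|` [set w | ~~ typ w].
    move=> w nrec; have [ty|] := boolP (typ w); last by right.
    left; rewrite /far /= ltNge; apply/negP => close; apply: nrec.
    apply: (typical_recovers T pi (p N) (delta N) gamma am c0 eps eta) => //.
    - move=> t tT; have /andP[-> _] := p_in01 N t tT.
      by rewrite p_scaling// ler_wpM2r ?(ltW d0)// a_am.
    - move=> l r wT; have [lT rT] := child _ _ wT.
      by rewrite !p_scaling// -!mulrDl !ler_pM2r//; apply: a_gap.
    - by move=> k; apply: pi_c0; rewrite mem_enum.
  have : (P N (~` rec N) <= P N (far N) + (C1 / (N%:R * delta N) + C2 / N%:R)%:E)%E.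
    apply: (@le_trans _ _ (P N (far N `|` [set w | ~~ typ w]))).
      by apply: le_measure => //; rewrite inE;
        [apply: measurableC|apply: measurableU].
    by apply: (le_trans (measureU2 _ _ _)) => //; apply: leeD.
  rewrite probability_setC//.
  (* All probabilities are finite, so the inequality is rearranged in [R]. *)
  rewrite -(fineK (fin_num_measure (P N) _ (mrec N))).
  rewrite -(fineK (fin_num_measure (P N) _ (mfar N))).
  by rewrite -!EFinD !lee_fin; lra.
have far0 : P N (far N) @[N --> \oo] --> 0%E by exact: Chat_almost_exact.
have rate0 : (C1 / (N%:R * delta N) + C2 / N%:R)%:E @[N --> \oo] --> 0%:E.
  apply: cvg_EFin; first exact: nearW.
  rewrite -[X in _ --> X]addr0; apply: cvgD; apply: cvg_inv_infty => //.
  exact: cvgr_idn.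
apply: (squeeze_cvge lower); last exact: cvg_cst.
rewrite -[X in _ --> X]sube0; apply: cvgeB => //; first exact: cvg_cst.
by rewrite -[X in _ --> X]adde0; apply: cvgeD.
Unshelve. all: by end_near. Qed.
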